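(* Let $P$ be a $\mu$-reversible Markov kernel on $(E,\mathscr{E})$. For $A\in\mathscr{E}$ with $\mu(A)>0$, let $P_A$ be the restriction of $P$ to $A$ and define $\gamma_P(A)$ to be the (right) ''spectral gap'' $$\gamma_P(A)=\inf_{f\in L^2(\mu)}\frac{\mathcal{E}(P_A,f)}{\mathrm{var}_{\mu_A}(f)} .$$ Then $P$ satisfies a $(\Phi,\beta)$-WPI (weak Poincaré inequality) with $\Phi=\|\cdot\|_{\mathrm{osc}}^2$ and $$\beta(s)=1\wedge\inf\left\{\mu(A^{\complement}):A\in\mathscr{E},\ \mu(A)>0,\ \gamma_P(A)\ge\frac{\mu(A)}{s}\right\}.$$
   Context: $(E,\mathscr{E})$ is a measurable space, $\mu$ a probability measure on it. $\|\cdot\|_2$ is the norm of $L^2(\mu)$; $L^2_0(\mu)$ is the set of real $f\in L^2(\mu)$ with $\mu(f)=0$; $\|f\|_{\mathrm{osc}}=\mathrm{ess}_\mu\sup f-\mathrm{ess}_\mu\inf f$; $\mathcal{E}(P,f)=\langle(\mathrm{Id}-P)f,f\rangle$ in $L^2(\mu)$. $(\Phi,\beta)$-WPI for $P$: $\beta:(0,\infty)\to[0,\infty)$ is a decreasing function with $\beta(s)\to0$ as $s\to\infty$, and $\|f\|_2^2\le s\,\mathcal{E}(P,f)+\beta(s)\Phi(f)$ for all $s>0$ and $f\in L^2_0(\mu)$. For $A$ with $\mu(A)>0$: $\mu_A(B)=\mu(A\cap B)/\mu(A)$, $\mathrm{var}_{\mu_A}$ is the variance under $\mu_A$, and the restriction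 of $P$ to $A$ is $P_Af(x)=P(f\cdot\mathbf{1}_A)(x)+f(x)P(x,A^{\complement})$, which is $\mu_A$-reversible; $\mathcal{E}(P_A,f)=\frac12\int\mu_A(\mathrm{d}x)P_A(x,\mathrm{d}y)[f(x)-f(y)]^2$. In the infimum defining $\gamma_P(A)$ the quotient is taken for $f$ with $\mathrm{var}_{\mu_A}(f)>0$. Convention: $\inf\emptyset=\infty$.
   Formalization: The requirement β(s)→0 in the WPI can fail (two points, μ uniform, P=Id gives β≡1/2); proved without it: β≥0, β non-increasing and the inequality for all s>0 and f in L²₀(μ); the full WPI is stated under the assumption β(s)→0. *)

(* Defs.v *)
From HB Require Import structures.
From mathcomp Require Import all_boot all_order all_algebra.
From mathcomp Require Import all_classical all_reals all_analysis.
From mathcomp Require Import measurable_realfun ess_sup_inf.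

Set Implicit Arguments.
Unset Strict Implicit.
Unset Printing Implicit Defensive.
Import Order.TTheory GRing.Theory Num.Theory.
Import numFieldNormedType.Exports.

Local Open Scope classical_set_scope.
Local Open Scope ring_scope.
Local Open Scope ereal_scope.

Section kernels.
Context d (E : measurableType d) (R : realType).
Variables (mu : probability E R) (P : R.-pker E ~> E).

Definition reversible : Prop :=
  forall A B : set E, measurable A -> measurable B ->
    \int[mu]_(x in A) P x B = \int[mu]_(x in B) P x A.

(* P f is a real function; where f is not P x-integrable (a mu-null set of x
   when P is mu-reversible and f is in L^2(mu)) its value is arbitrary. *)
Definition kernel_op (f : E -> R) (x : E) : R := (\int[P x]_y f y)%R.

Definition dirichlet (f : E -> R) : \bar R :=
  \int[mu]_x ((f x - kernel_op f x) * f x)%:E.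

Definition osc (f : E -> R) : \bar R :=
  ess_sup mu (EFin \o f) - ess_inf mu (EFin \o f).

Lemma fin_num_kernel (x : E) (B : set E) :
  measurable B -> P x B \is a fin_num.
Proof.
move=> mB; rewrite ge0_fin_numE// (@le_lt_trans _ _ 1)// ?ltry//.
by rewrite -(prob_kernel (s := P) x) le_measure ?inE.
Qed.

Section restriction.
Variables (A : set E) (mA : measurable A).

(* When mu A = 0, mnormalize returns its last argument, here mu. *)
Definition cond_prob : probability E R := mnormalize (mrestr mu mA) mu.

Lemma cond_probE (B : set E) : 0 < mu A -> cond_prob B = mu (A `&` B) / mu A.
Proof.
move=> A0; have Afin : mu A \is a fin_num by exact: fin_num_measure.
rewrite /cond_prob/= /mnormalize/= /mrestr setTI gt_eqF//=.
rewrite ifF; last by apply/negbTE; move: Afin; rewrite fin_numE => /andP[].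
rewrite setIC -[in RHS](fineK Afin) inver ifF//.
by apply/negbTE; rewrite fine_eq0// gt_eqF.
Qed.

(* P_A(x, B) = P(x, A `&` B) + P(x, ~` A) 1_B(x), the kernel of the operator
   f |-> P (f 1_A) + f P(., ~` A); see ge0_integral_restr_ker. *)
Definition restr_ker (x : E) : {measure set E -> \bar R} :=
  measure_add (mrestr (P x) mA)
    (mscale (NngNum (fine_ge0 (measure_ge0 (P x) (~` A)))) (\d_x)).

Lemma restr_kerE (x : E) (B : set E) :
  restr_ker x B = P x (A `&` B) + P x (~` A) * (\1_B x)%:E.
Proof.
rewrite [LHS]measure_addE /mrestr/= /mscale/= diracE indicE setIC.
by rewrite fineK// fin_num_kernel//; exact: measurableC.
Qed.

Lemma ge0_integral_restr_ker (f : E -> R) (x : E) :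
  measurable_fun setT f -> (forall y, (0 <= f y)%R) ->
  \int[restr_ker x]_y (f y)%:E =
  \int[P x]_y (f y * \1_A y)%:E + (f x)%:E * P x (~` A).
Proof.
move=> mf f0; have mf' : measurable_fun setT (fun y => (f y)%:E).
  exact/measurable_EFinP.
rewrite ge0_integral_measure_add//; last by move=> *; rewrite lee_fin.
rewrite ge0_integral_mscale//; last by move=> *; rewrite lee_fin.
rewrite integral_dirac// diracT mul1e/= fineK; last first.
  by rewrite fin_num_kernel//; exact: measurableC.
rewrite muleC; congr (_ + _).
transitivity (\int[mrestr (P x) mA]_(y in A `|` ~` A) (f y)%:E).
  by rewrite setUv.
rewrite ge0_integral_setU//=; last 4 first.
- exact: measurableC.
- by rewrite setUv.
- by move=> *; rewrite lee_fin.
- exact/disj_setPCl.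
rewrite [X in _ + X]null_set_integral//; last 3 first.
- exact: measurableC.
- exact: measurable_funTS.
- by rewrite [LHS](congr1 (P x) (setICl A)) measure0.
rewrite adde0 [LHS](eq_measure_integral (P x)); last first.
  by move=> B mB BA; rewrite [LHS](congr1 (P x) (setIidl BA)).
rewrite integral_mkcond; apply: eq_integral => y _.
by rewrite patchE indicE; case: ifP => _; rewrite ?mulr1 ?mulr0.
Qed.

Definition restr_energy (f : E -> R) : \bar R :=
  (2^-1)%:E *
  \int[cond_prob]_x \int[restr_ker x]_y ((f x - f y) ^+ 2)%:E.

Definition restr_gap : \bar R :=
  ereal_inf [set restr_energy f / variance cond_prob f |
             f in [set f | f \in Lfun mu 2%:E /\ 0 < variance cond_prob f]].

End restriction.

(* The weak Poincare inequality without the requirement that beta vanish at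
   infinity. As 0 * +oo = 0, the inequality is also asserted for f with
   Phi f = +oo when beta s = 0. *)
Definition weak_poincare (Phi : (E -> R) -> \bar R) (beta : R -> R) : Prop :=
  [/\ (forall s : R, (0 < s)%R -> (0 <= beta s)%R),
      (forall s t : R, (0 < s)%R -> (s <= t)%R -> (beta t <= beta s)%R) &
      (forall (s : R) (f : E -> R), (0 < s)%R ->
         f \in Lfun mu 2%:E -> \int[mu]_x (f x)%:E = 0 ->
         ('N[mu]_2%:E[EFin \o f])%E ^+ 2
           <= s%:E * dirichlet f + (beta s)%:E * Phi f)].

Definition WPI (Phi : (E -> R) -> \bar R) (beta : R -> R) : Prop :=
  weak_poincare Phi beta /\ beta s @[s --> +oo%R] --> (0 : R)%R.

Definition beta_inf (s : R) : \bar R :=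
  ereal_inf [set r | exists (A : set E) (mA : measurable A),
    [/\ 0 < mu A, mu A / s%:E <= restr_gap mA & r = mu (~` A)]].

Definition restr_beta (s : R) : R := fine (mine 1 (beta_inf s)).

Lemma restr_betaE (s : R) : (restr_beta s)%:E = mine 1 (beta_inf s).
Proof.
rewrite /restr_beta fineK// ge0_fin_numE.
  by rewrite (@le_lt_trans _ _ 1)// ?ge_min ?lexx// ltry.
rewrite le_min lee01/=; apply: le_ereal_inf_tmp => _ [A [mA [_ _ ->]]].
exact: measure_ge0.
Qed.

End kernels.

(* Main.v *)
Require Import Defs.
From mathcomp Require Import all_boot all_order all_algebra.
From mathcomp Require Import all_classical all_reals all_analysis.
From mathcomp Require Import measurable_realfun ess_sup_inf ring lra.
Import Order.TTheory GRing.Theory Num.Theory.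
Import numFieldNormedType.Exports.
Local Open Scope classical_set_scope.
Local Open Scope ring_scope.

(* Invariance of mu gives 2 E(P,f) = int mu(dx) int P(x,dy) (f x - f y)^2, so
   that E(P_A,f) <= E(P,f) / mu(A). If gamma_P(A) >= mu(A)/s, then with
   p = mu(A), q = 1 - p, J = int_A f^2 and a = int_A f,
     p J - a^2 = p^2 var_{mu_A}(f) <= s E(P,f).
   For mu(f) = 0 the defect ||f||^2 - (p J - a^2) is at most q osc(f)^2: with
   m <= f <= M, integrate (f - m)(M - f) >= 0 over A and its complement. Taking
   the infimum over A gives the inequality when osc(f) is finite.
   If osc(f) is infinite, only beta(s) = 0 matters: the defect is bounded by
   int_{A^c} f^2 + q ||f||^2 + (int_{A^c} f)^2, which tends to 0 with q. *)

Set Implicit Arguments.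
Unset Strict Implicit.
Local Open Scope ereal_scope.

(** Reversibility tested against [setT] says that the composite of the constant kernel [mu] with [P]
    is [mu] itself; the integral formula for composite kernels then passes from sets to [h]. *)
Lemma ge0_integral_invariant (d : measure_display) (E : measurableType d)
    (R : realType) (mu : probability E R) (P : R.-pker E ~> E)
    (h : E -> \bar R) :
  reversible mu P -> measurable_fun setT h -> (forall x, 0 <= h x) ->
  \int[mu]_x \int[P x]_y h y = \int[mu]_x h x.
Proof.
move=> rev mh h0.
pose l : R.-pker unit ~> E :=
  kprobability (measurable_cst (mu : pprobability E R)).
pose k : R.-spker (unit * E)%type ~> E := kernel.kernel_snd P.
rewrite -[LHS](integral_kcomp l k tt h0 mh).
apply: eq_measure_integral => B mB _.
rewrite /= /kcomp /=.
transitivity (\int[mu]_(x in setT) P x B) => [//|].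
rewrite rev// (eq_integral (cst 1)) => [|x _]; last by rewrite /= prob_kernel.
by rewrite integral_cst// mul1e.
Qed.

(** * Square-integrable functions *)

Section L2.
Context d (T : measurableType d) (R : realType).
Variable mu : {measure set T -> \bar R}.

(** This form transfers to other measures: for [P x] and [cond_prob] only the integral of the square
    remains to be bounded. *)
Lemma Lfun2P (f : T -> R) : f \in Lfun mu 2%:E <->
  measurable_fun setT f /\ \int[mu]_x (f x ^+ 2)%:E < +oo.
Proof.
have E : \int[mu]_x (f x ^+ 2)%:E = 'N[mu]_2%:E[EFin \o f] `^ 2.
  rewrite powR_Lnorm//; apply: eq_integral => x _.
  by rewrite /= powR_mulrn// -normrX ger0_norm// sqr_ge0.
split=> [f2|[mf fi]].
  split; first by move: f2; rewrite inE => /andP[/[!inE]].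
  exact/integrable_lty/Lfun2_integrable_sqr.
rewrite inE; apply/andP; split; rewrite inE//=.
by rewrite /finite_norm (@lty_poweRy _ _ 2)// -E.
Qed.

Lemma Lnorm2_sqr (f : T -> R) :
  'N[mu]_2%:E[EFin \o f] ^+ 2 = \int[mu]_x (f x ^+ 2)%:E.
Proof.
transitivity ('N[mu]_2%:E[EFin \o f] `^ 2); last first.
  rewrite powR_Lnorm//; apply: eq_integral => x _.
  by rewrite /= powR_mulrn// -normrX ger0_norm// sqr_ge0.
have := Lnorm_ge0 mu 2%:E (EFin \o f).
case: ('N[mu]_2%:E[EFin \o f]) => [r r0| _|//].
  by rewrite poweR_EFin powR_mulrn// -EFin_expe.
by rewrite expe2 mulyy poweRyr.
Qed.

(** Meant for the probability measures [P x]: [c = f x] leads to the Dirichlet form,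
    [c = kernel_op P f x] to Jensen's inequality. *)
Lemma integral_sqr_subr (f : T -> R) (c : R) :
  mu setT = 1 -> f \in Lfun mu 2%:E ->
  \int[mu]_x ((c - f x) ^+ 2)%:E =
  (c ^+ 2 - 2 * c * \int[mu]_x f x + \int[mu]_x f x ^+ 2)%:E.
Proof.
move=> mu1 f2.
have if1 : mu.-integrable setT (EFin \o f).
  by apply/Lfun1_integrable/Lfun_subset12 => //; rewrite mu1.
have if2 := Lfun2_integrable_sqr f2.
have ic : mu.-integrable setT (EFin \o cst (c ^+ 2)%R).
  apply/integrableP; split; first exact/measurable_EFinP.
  by rewrite (eq_integral (cst (`|c ^+ 2|%:E)))// integral_cst// mu1 mule1 ltry.
have icf : mu.-integrable setT (EFin \o (fun x => 2 * c * f x)%R).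
  exact: (integrableZl _ _ if1).
have ics : mu.-integrable setT (EFin \o (fun x => c ^+ 2 - 2 * c * f x)%R).
  exact: (integrableB _ ic icf).
transitivity (\int[mu]_x (c ^+ 2 - 2 * c * f x + f x ^+ 2)%:E).
  by apply: eq_integral => x _; congr EFin; ring.
rewrite -[LHS]fineK; last exact: (integrable_fin_num _ (integrableD _ ics if2)).
congr EFin; rewrite -[LHS]/(\int[mu]_x _)%R.
by rewrite RintegralD// RintegralB// RintegralZl// Rintegral_cst// mu1 mulr1.
Qed.

End L2.

(** * The Dirichlet form as a double integral of squared differences *)

Section dirichlet.
Context d (E : measurableType d) (R : realType).
Variables (mu : probability E R) (P : R.-pker E ~> E) (f : E -> R).
Hypotheses (P_rev : reversible mu P) (f2 : f \in Lfun mu 2%:E).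

Let mf : measurable_fun setT f. Proof. by have /Lfun2P[] := f2. Qed.

(** By invariance this function has finite integral, hence is finite [mu]-almost everywhere; at such
    points [f] is in L^2 of [P x] and squares can be expanded under the kernel. *)
Let F x := \int[P x]_y (f y ^+ 2)%:E.

Let F0 x : 0 <= F x.
Proof. by apply: integral_ge0 => y _; rewrite lee_fin sqr_ge0. Qed.

Let mf2 : measurable_fun setT (fun x => (f x ^+ 2)%:E).
Proof. by apply/measurable_EFinP; exact: measurable_funX. Qed.

Let mF : measurable_fun setT F.
Proof.
apply: measurable_fun_integral_kernel => // [U mU|y].
  exact: measurable_kernel.
by rewrite lee_fin sqr_ge0.
Qed.

Let intF : \int[mu]_x F x = \int[mu]_x (f x ^+ 2)%:E.
Proof.
by apply: ge0_integral_invariant => // x; rewrite lee_fin sqr_ge0.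
Qed.

Let iF : mu.-integrable setT F.
Proof.
apply/integrableP; split => //.
under eq_integral do rewrite gee0_abs//.
by rewrite intF; have /Lfun2P[] := f2.
Qed.

Let f2P x : F x < +oo -> f \in Lfun (P x) 2%:E.
Proof. by move=> Fx; apply/Lfun2P. Qed.

Let G x := \int[P x]_y ((f x - f y) ^+ 2)%:E.
Let k := kernel_op P f.

Let sqr_sub_kernel x (c : R) : F x < +oo ->
  \int[P x]_y ((c - f y) ^+ 2)%:E = (c ^+ 2 - 2 * c * k x)%:E + F x.
Proof.
move=> Fx; rewrite integral_sqr_subr ?prob_kernel//; last exact: f2P.
rewrite EFinD; congr (_ + _).
by rewrite fineK// ge0_fin_numE//; exact: F0.
Qed.

Let mG : measurable_fun setT G.
Proof.
apply: (measurable_fun_integral_finite_kernel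
  (fun z : E * E => ((f z.1 - f z.2) ^+ 2)%:E) P) => [z|].
  by rewrite lee_fin sqr_ge0.
apply/measurable_EFinP; apply: measurable_funX.
by apply: measurable_funB; apply: measurableT_comp.
Qed.

(** Where [F x] is finite, the integral of [(k x - f y) ^+ 2] under [P x] is [F x - k x ^+ 2], the
    variance of [f]. Where [F x = +oo], any value of [k x] will do. *)
Lemma kernel_op_sqr_le x : (k x ^+ 2)%:E <= F x.
Proof.
have [Fx|] := ltP (F x) +oo; last by rewrite leye_eq => /eqP ->; rewrite leey.
have : 0 <= \int[P x]_y ((k x - f y) ^+ 2)%:E.
  by apply: integral_ge0 => y _; rewrite lee_fin sqr_ge0.
rewrite sqr_sub_kernel//; have : F x \is a fin_num by rewrite ge0_fin_numE.
by case: (F x) => // r _; rewrite -EFinD !lee_fin => ?; nra.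
Qed.

Lemma measurable_kernel_op : measurable_fun setT k.
Proof.
rewrite /k /kernel_op; apply: (measurableT_comp (f := fine)) => //.
under eq_fun do rewrite integralE.
apply: emeasurable_funB; apply: measurable_fun_integral_kernel => //.
- by move=> U mU; exact: measurable_kernel.
- by apply: measurable_funepos; exact/measurable_EFinP.
- by move=> U mU; exact: measurable_kernel.
- by apply: measurable_funeneg; exact/measurable_EFinP.
Qed.

(** The dominating function comes from [|f k| <= f ^+ 2 + k ^+ 2] and Jensen's inequality
    [k ^+ 2 <= F]. *)
Let ifk : mu.-integrable setT (fun x => (f x * k x)%:E).
Proof.
apply: (le_integrable _ _ (g := fun x => (f x ^+ 2)%:E + F x)) => //.
- apply/measurable_EFinP; apply: measurable_funM => //.
  exact: measurable_kernel_op.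
- move=> x _; rewrite [leRHS]gee0_abs; last first.
    by rewrite adde_ge0 ?lee_fin ?sqr_ge0 ?F0.
  apply: (@le_trans _ _ ((f x ^+ 2)%:E + (k x ^+ 2)%:E)).
    rewrite -EFinD lee_fin.
    rewrite ler_norml; apply/andP; split; nra.
  by rewrite leeD2l// kernel_op_sqr_le.
- exact: (integrableD measurableT (Lfun2_integrable_sqr f2) iF).
Qed.

Lemma dirichletE : dirichlet mu P f =
  \int[mu]_x (f x ^+ 2)%:E - \int[mu]_x (f x * k x)%:E.
Proof.
rewrite /dirichlet -integralB_EFin//; last exact: Lfun2_integrable_sqr.
by apply: eq_integral => x _; rewrite -EFinB; congr EFin; rewrite /k; ring.
Qed.

Lemma dirichlet_fin_num : dirichlet mu P f \is a fin_num.
Proof.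
rewrite dirichletE fin_numB; apply/andP; split; apply: integrable_fin_num => //.
exact: Lfun2_integrable_sqr.
Qed.

(** Wherever [F x] is finite, so almost everywhere, [G x = f x ^+ 2 - 2 * (f x * k x) + F x]; by
    invariance the last term has the same integral as the first. *)
Lemma integral_sqr_sub_kernel : \int[mu]_x G x = 2%:E * dirichlet mu P f.
Proof.
have i2 := Lfun2_integrable_sqr f2.
have i2k : mu.-integrable setT (fun x => 2%:E * (f x * k x)%:E).
  exact: (integrableZl measurableT 2 ifk).
have iH : mu.-integrable setT (fun x => (f x ^+ 2)%:E - 2%:E * (f x * k x)%:E).
  exact: (integrableB measurableT i2 i2k).
transitivity (\int[mu]_x ((f x ^+ 2)%:E - 2%:E * (f x * k x)%:E + F x)).
  apply: ae_eq_integral => //.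
    exact: (measurable_int _ (integrableD measurableT iH iF)).
  have := integrable_ae measurableT iF; apply: filterS => x /(_ I) Fx _.
  rewrite /G sqr_sub_kernel//; last by rewrite -ge0_fin_numE.
  by rewrite -EFinM -EFinB; congr (EFin _ + _); ring.
rewrite integralD//.
rewrite integralB//.
rewrite integralZl// intF dirichletE.
have := integrable_fin_num measurableT ifk.
have := integrable_fin_num measurableT i2.
case: (\int[mu]_x _) => // a _; case: (\int[mu]_x _) => // b _.
by rewrite -EFinM -!EFinB -EFinD -EFinM; congr EFin; ring.
Qed.
End dirichlet.

(** * Integrals and variance under the conditioned measure *)

Section cond_prob.
Context d (E : measurableType d) (R : realType) (mu : probability E R).
Variables (A : set E) (mA : measurable A) (A0 : 0 < mu A).

Let p := fine (mu A).

Let pE : mu A = p%:E.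
Proof. by rewrite fineK// fin_num_measure. Qed.

Let p0 : (0 < p)%R.
Proof. by rewrite -lte_fin -pE. Qed.

Lemma ge0_integral_cond_prob (g : E -> \bar R) :
  measurable_fun setT g -> (forall x, 0 <= g x) ->
  \int[cond_prob mu mA]_x g x = p^-1%:E * \int[mu]_(x in A) g x.
Proof.
move=> mg g0.
have p'0 : (0 <= p^-1)%R by rewrite invr_ge0 ltW.
transitivity (\int[mscale (NngNum p'0) (mrestr mu mA)]_x g x).
  apply: eq_measure_integral => B mB _.
  rewrite [LHS](cond_probE mA)// pE inver gt_eqF// muleC.
  by rewrite /mscale/= /mrestr setIC.
rewrite ge0_integral_mscale//=; congr (_ * _).
rewrite -[in LHS](setUv A) ge0_integral_setU//; last 3 first.
- exact: measurableC.
- by rewrite setUv.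
- exact/disj_setPCl.
rewrite [X in _ + X]null_set_integral//; last 3 first.
- exact: measurableC.
- exact: measurable_funTS.
- by rewrite [LHS](congr1 mu (setICl A)) measure0.
rewrite adde0; apply: eq_measure_integral => B mB BA.
by rewrite [LHS](congr1 mu (setIidl BA)).
Qed.

Variable f : E -> R.
Hypothesis f2 : f \in Lfun mu 2%:E.

Let mf : measurable_fun setT f. Proof. by have /Lfun2P[] := f2. Qed.

Let mf2 : measurable_fun setT (fun x => (f x ^+ 2)%:E).
Proof. by apply/measurable_EFinP; exact: measurable_funX. Qed.

Lemma Lfun2_integrable B : measurable B -> mu.-integrable B (EFin \o f).
Proof.
move=> mB; apply: (integrableS measurableT) => //.
by apply/Lfun1_integrable/Lfun_subset12 => //; exact: fin_num_measure.
Qed.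

Lemma Lfun2_integrable_sqr_in B : measurable B ->
  mu.-integrable B (fun x => (f x ^+ 2)%:E).
Proof.
move=> mB; apply: (integrableS measurableT) => //.
exact: Lfun2_integrable_sqr.
Qed.

Let int2 : \int[cond_prob mu mA]_x (f x ^+ 2)%:E =
  (p^-1 * \int[mu]_(x in A) f x ^+ 2)%:E.
Proof.
rewrite ge0_integral_cond_prob//; last by move=> x; rewrite lee_fin sqr_ge0.
rewrite EFinM fineK//; apply: integrable_fin_num => //.
exact: Lfun2_integrable_sqr_in.
Qed.

Lemma Lfun2_cond_prob : f \in Lfun (cond_prob mu mA) 2%:E.
Proof. by apply/Lfun2P; split=> //; rewrite int2 ltry. Qed.

Lemma variance_cond_prob : variance (cond_prob mu mA) f =
  (p^-1 * \int[mu]_(x in A) f x ^+ 2 - (p^-1 * \int[mu]_(x in A) f x) ^+ 2)%:E.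
Proof.
rewrite varianceE; last exact: Lfun2_cond_prob.
rewrite EFinB; congr (_ - _).
  by rewrite -int2 unlock.
rewrite unlock EFin_expe; congr (_ ^+ 2).
have iA := Lfun2_integrable mA.
(* The formula for nonnegative integrands is applied to the positive and negative parts; the finite
   integral of the positive part allows them to be recombined. *)
rewrite integralE !ge0_integral_cond_prob//; last 2 first.
- by apply: measurable_funeneg; exact/measurable_EFinP.
- by apply: measurable_funepos; exact/measurable_EFinP.
rewrite -muleBr//; last first.
  by apply: fin_num_adde_defr; exact: integrable_pos_fin_num.
by rewrite -integralE EFinM fineK//; exact: integrable_fin_num.
Qed.

End cond_prob.

(** * From the gap of a restriction to the Dirichlet form of [P] *)

Section gap.
Context d (E : measurableType d) (R : realType).
Variables (mu : probability E R) (P : R.-pker E ~> E).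
Hypothesis (P_rev : reversible mu P).
Variables (A : set E) (mA : measurable A) (A0 : 0 < mu A) (f : E -> R).
Hypothesis f2 : f \in Lfun mu 2%:E.

Let mf : measurable_fun setT f. Proof. by have /Lfun2P[] := f2. Qed.

Lemma dirichlet_ge0 : 0 <= dirichlet mu P f.
Proof.
rewrite -(@pmule_rge0 _ 2%:E) ?lte_fin// -integral_sqr_sub_kernel//.
by do 2!apply: integral_ge0 => ? _; rewrite lee_fin sqr_ge0.
Qed.

(** The holding part of the restricted kernel sits on the diagonal, where [(f x - f y) ^+ 2]
    vanishes. What remains is an integral over [A] in both variables, which grows when first [x] and
    then [y] ranges over all of [E]. *)
Lemma restr_energy_le :
  restr_energy mu P mA f <= (fine (mu A))^-1%:E * dirichlet mu P f.
Proof.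
have mg (B : set E) : measurable B ->
    measurable_fun setT (fun x => \int[P x]_y ((f x - f y) ^+ 2 * \1_B y)%:E).
  move=> mB; apply: (measurable_fun_integral_finite_kernel
    (fun z : E * E => ((f z.1 - f z.2) ^+ 2 * \1_B z.2)%:E) P) => [z|].
    by rewrite lee_fin mulr_ge0// sqr_ge0.
  apply/measurable_EFinP; apply: measurable_funM.
    apply: measurable_funX.
    by apply: measurable_funB; apply: measurableT_comp.
  by apply: measurableT_comp => //; exact: measurable_indic.
have sub0 (x y : E) : (0 <= (f x - f y) ^+ 2)%R by exact: sqr_ge0.
have msub (x : E) : measurable_fun setT (fun y => (f x - f y) ^+ 2)%R.
  by apply: measurable_funX; exact: measurable_funB.
rewrite /restr_energy (eq_integral
  (fun x => \int[P x]_y ((f x - f y) ^+ 2 * \1_A y)%:E)); last first.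
  move=> x _; rewrite ge0_integral_restr_ker//.
  by rewrite subrr expr0n/= mul0e adde0.
rewrite ge0_integral_cond_prob//; last 2 first.
- exact: mg.
- by move=> x; apply: integral_ge0 => y _; rewrite lee_fin mulr_ge0.
rewrite muleCA lee_wpmul2l ?lee_fin ?invr_ge0 ?fine_ge0//.
rewrite lee_pdivrMl// -integral_sqr_sub_kernel//.
apply: (@le_trans _ _ (\int[mu]_x \int[P x]_y ((f x - f y) ^+ 2 * \1_A y)%:E)).
  apply: ge0_subset_integral => //; first exact: mg.
  by move=> x _; apply: integral_ge0 => y _; rewrite lee_fin mulr_ge0.
apply: ge0_le_integral => //.
- by move=> x _; apply: integral_ge0 => y _; rewrite lee_fin mulr_ge0.
- exact: mg.
- have := mg setT measurableT; apply: eq_measurable_fun => x _.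
  by apply: eq_integral => y _; rewrite indicT mulr1.
move=> x _; apply: ge0_le_integral => //.
- by move=> y _; rewrite lee_fin mulr_ge0.
- apply/measurable_EFinP; apply: measurable_funM => //.
- exact/measurable_EFinP.
- by move=> y _; rewrite lee_fin ler_piMr// indicE; case: (y \in A).
Qed.

(** With [p = mu A] and [v] the conditioned variance, the left side is [p ^+ 2 * v]. Testing the gap
    on [f] gives [p / s * v <= p^-1 * D], which is then multiplied by [p * s]. *)
Lemma restr_gap_sqr_le (s : R) :
  (0 < s)%R -> mu A / s%:E <= restr_gap mu P mA ->
  (fine (mu A) * \int[mu]_(x in A) f x ^+ 2 - (\int[mu]_(x in A) f x) ^+ 2
   <= s * fine (dirichlet mu P f))%R.
Proof.
move=> s0 gap.
have Ap : mu A = (fine (mu A))%:E by rewrite fineK// fin_num_measure.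
have p0 : (0 < fine (mu A))%R by rewrite -lte_fin -Ap.
have Dfin := dirichlet_fin_num P_rev f2.
have D0 : (0 <= fine (dirichlet mu P f))%R.
  by rewrite fine_ge0// dirichlet_ge0.
have := variance_cond_prob mA A0 f2.
have := restr_energy_le.
move: gap D0 p0; rewrite {1}Ap -{2}(fineK Dfin).
set p := fine (mu A); set J := (\int[mu]_(x in A) (_ ^+ 2))%R.
set a := (\int[mu]_(x in A) f x)%R; set D := fine _ => gap D0 p0 le VE.
have VV : (p * J - a ^+ 2 = p ^+ 2 * (p^-1 * J - (p^-1 * a) ^+ 2))%R.
  by field; rewrite gt_eqF.
rewrite VV; move: VE; set v := (_ - _ ^+ 2)%R => VE.
(* [f] competes in the infimum only if its variance is positive; otherwise the left side is at most
   0 and [s * D] is nonnegative. *)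
have [v0|v0] := leP v 0%R.
  rewrite (@le_trans _ _ 0%R)//; first by rewrite mulr_ge0_le0// sqr_ge0.
  by rewrite mulr_ge0// ltW.
have : p%:E / s%:E <= restr_energy mu P mA f / v%:E.
  apply: (le_trans gap); apply: ereal_inf_lbound; exists f; rewrite ?VE//.
  by split=> //=; rewrite VE lte_fin.
rewrite !inver !gt_eqF// lee_pdivlMr// => /le_trans/(_ le).
rewrite -!EFinM lee_fin => le'.
have -> : (p ^+ 2 * v = p * s * (p * s^-1 * v))%R by field; rewrite gt_eqF.
have -> : (s * D = p * s * (p^-1 * D))%R by field; rewrite gt_eqF.
by rewrite ler_pM2l// mulr_gt0.
Qed.
End gap.

(** Here [p] is the mass of [A], [a] and [J] are the integrals of [f] and [f ^+ 2] over [A], and [K]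
    is that of [f ^+ 2] over the complement. The defect is [K + (1 - p) * J + a ^+ 2]; [h1] bounds
    [a ^+ 2] because [a] lies between the two roots of the product. *)
Lemma bounded_variance_defect (R : realFieldType) (m M p a J K : R) :
  (0 <= p <= 1 -> m <= 0 -> 0 <= M ->
   - (M * (1 - p)) <= a -> a <= - (m * (1 - p)) ->
   J <= (m + M) * a - m * M * p -> K <= (m + M) * - a - m * M * (1 - p) ->
   (K + J) - (p * J - a ^+ 2) <= (1 - p) * (M - m) ^+ 2)%R.
Proof.
move=> /andP[p0 p1] m0 M0 aM am JM KM.
have q0 : (0 <= 1 - p)%R by rewrite subr_ge0.
have mM : (m * M <= 0)%R by rewrite mulr_le0_ge0.
have h1 : ((a + m * (1 - p)) * (a + M * (1 - p)) <= 0)%R.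
  by apply: mulr_le0_ge0; lra.
have h2 : ((1 - p) * J <= (1 - p) * ((m + M) * a - m * M * p))%R.
  by rewrite ler_wpM2l.
(* The left side is the sum of the bounds on [a ^+ 2], [(1 - p) * J] and [K]. It is affine in [a],
   so it is estimated at the endpoint selected by the sign of [m + M]. *)
have h3 : (- (m + M) * a - 2 * (m * M) * (1 - p) <= (1 - p) * (M - m) ^+ 2)%R.
  have h4 : (0 <= (1 - p) * (M ^+ 2))%R by rewrite mulr_ge0// sqr_ge0.
  have h5 : (0 <= (1 - p) * (m ^+ 2))%R by rewrite mulr_ge0// sqr_ge0.
  have h6 : (0 <= (1 - p) * - (m * M))%R by rewrite mulr_ge0// oppr_ge0.
  have [h|/ltW h] := leP 0%R (m + M)%R.
    have : (0 <= (m + M) * (a + M * (1 - p)))%R by apply: mulr_ge0 => //; lra.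
    lra.
  have : (0 <= (m + M) * (a + m * (1 - p)))%R by apply: mulr_le0 => //; lra.
  lra.
lra.
Qed.

(** * Essential bounds and the integrals they control *)

Section oscillation.
Context d (E : measurableType d) (R : realType) (mu : probability E R).
Variable f : E -> R.

Lemma ae_ex (Q : set E) : {ae mu, forall x, Q x} -> exists x, Q x.
Proof.
move=> aeQ; apply: contrapT => /forallNP nQ.
have : {ae mu, forall x : E, False} by apply: filterS aeQ => x /nQ.
case=> N [mN N0]; rewrite (_ : (~` _) = setT); last first.
  by apply/seteqP; split=> // x _ [].
rewrite subTset => NT; move: N0; rewrite NT probability_setT => /eqP.
by rewrite onee_eq0.
Qed.

(** On a probability space the essential supremum is not [-oo] and the essential infimum is not
    [+oo], since an almost sure property holds at some point. A difference below [+oo] then forces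
    both to be finite. *)
Lemma osc_bounded : osc mu f < +oo -> exists m M : R,
  osc mu f = (M - m)%:E /\ {ae mu, forall x, (m <= f x <= M)%R}.
Proof.
rewrite /osc; have leS := ess_sup_ge mu (EFin \o f).
have leI := ess_inf_le mu (EFin \o f).
have : ess_sup mu (EFin \o f) <> -oo.
  by move=> S; move: leS; rewrite S => /ae_ex[x]; rewrite leeNy_eq.
have : ess_inf mu (EFin \o f) <> +oo.
  by move=> S; move: leI; rewrite S => /ae_ex[x]; rewrite leye_eq.
case: (ess_inf _ _) leI => [m| |]//= leI _;
  case: (ess_sup _ _) leS => [M| |]//= leS _ _.
exists m, M; split=> //; apply: filterS2 leI leS => x.
by rewrite !lee_fin => -> ->.
Qed.

Lemma ae_Rintegral_ge0 (B : set E) (h : E -> R) : measurable B ->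
  mu.-integrable B (EFin \o h) -> {ae mu, forall x, (0 <= h x)%R} ->
  (0 <= \int[mu]_(x in B) h x)%R.
Proof.
move=> mB ih h0; rewrite /Rintegral fine_ge0//.
have mh := measurable_int mu ih.
rewrite (ae_eq_integral (fun x => `|(h x)%:E|))//; last 2 first.
- exact: measurableT_comp.
- by apply: filterS h0 => x hx _ /=; rewrite ger0_norm.
by apply: integral_ge0 => x _; exact: abse_ge0.
Qed.

Variables (m M : R).
Hypotheses (f2 : f \in Lfun mu 2%:E).
Hypothesis fmM : {ae mu, forall x, (m <= f x <= M)%R}.

(** The third bound integrates [(f - m) * (M - f) >= 0] over [B]. *)
Lemma bounded_Rintegral (B : set E) : measurable B ->
  [/\ (m * fine (mu B) <= \int[mu]_(x in B) f x)%R,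
      (\int[mu]_(x in B) f x <= M * fine (mu B))%R &
      (\int[mu]_(x in B) f x ^+ 2
        <= (m + M) * \int[mu]_(x in B) f x - m * M * fine (mu B))%R].
Proof.
move=> mB.
have if1 := Lfun2_integrable f2 mB; have if2 := Lfun2_integrable_sqr_in f2 mB.
have ic c : mu.-integrable B (EFin \o cst c).
  exact: finite_measure_integrable_cst.
have ifc c : mu.-integrable B (EFin \o (fun x => c * f x)%R).
  exact: (integrableZl mB c if1).
split; rewrite -subr_ge0.
- rewrite -Rintegral_cst// -RintegralB//; last exact: ic.
  apply: ae_Rintegral_ge0 => //; first exact: (integrableB mB if1 (ic m)).
  by apply: filterS fmM => x /andP[? ?]; rewrite subr_ge0.
- rewrite -Rintegral_cst// -RintegralB//; last exact: ic.
  apply: ae_Rintegral_ge0 => //; first exact: (integrableB mB (ic M) if1).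
  by apply: filterS fmM => x /andP[? ?]; rewrite subr_ge0.
- have ifcm := integrableB mB (ifc (m + M)%R) (ic (m * M)%R).
  rewrite -Rintegral_cst// -RintegralZl// -RintegralB//; last exact: ic.
  rewrite -RintegralB//.
  apply: ae_Rintegral_ge0 => //; first exact: (integrableB mB ifcm if2).
  apply: filterS fmM => x /andP[h1 h2].
  have := mulr_ge0; move=> /(_ R (f x - m) (M - f x))%R.
  by rewrite !subr_ge0 => /(_ h1 h2); lra.
Qed.

End oscillation.

(** * The weak Poincare inequality *)

Section weak_poincare.
Context d (E : measurableType d) (R : realType).
Variables (mu : probability E R) (P : R.-pker E ~> E).
Hypothesis P_rev : reversible mu P.

Lemma Rintegral_setC (A : set E) (h : E -> R) : measurable A ->
  mu.-integrable setT (EFin \o h) ->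
  (\int[mu]_x h x = \int[mu]_(x in A) h x + \int[mu]_(x in ~` A) h x)%R.
Proof.
move=> mA ih; rewrite -Rintegral_setU ?setUv//; first exact: measurableC.
exact/disj_setPCl.
Qed.

Lemma fine_setC (A : set E) : measurable A ->
  (fine (mu (~` A)) = 1 - fine (mu A))%R.
Proof.
by move=> mA; rewrite probability_setC// fineB// fin_num_measure.
Qed.

Lemma fine_prob_itv (A : set E) : measurable A -> (0 <= fine (mu A) <= 1)%R.
Proof.
move=> mA; rewrite fine_ge0//= -lee_fin fineK ?fin_num_measure//.
exact: probability_le1.
Qed.

Lemma restr_beta_ge0 (s : R) : (0 <= restr_beta mu P s)%R.
Proof.
rewrite -lee_fin restr_betaE le_min lee01/=.
by apply: le_ereal_inf_tmp => _ [A [mA [_ _ ->]]]; exact: measure_ge0.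
Qed.

(** A larger parameter lowers the threshold on the gap, so the infimum is taken over more sets. *)
Lemma restr_beta_nincr (s t : R) : (0 < s)%R -> (s <= t)%R ->
  (restr_beta mu P t <= restr_beta mu P s)%R.
Proof.
move=> s0 st; rewrite -lee_fin !restr_betaE le_min !ge_min lexx/=.
apply/orP; right; apply: ereal_inf_le_tmp => _ [A [mA [A0 gap ->]]].
exists A, mA; split=> //; apply: le_trans gap.
have t0 := lt_le_trans s0 st.
by rewrite !inver !gt_eqF// lee_wpmul2l// lee_fin lef_pV2.
Qed.

Section inequality.
Variables (s : R) (f : E -> R).
Hypotheses (s0 : (0 < s)%R) (f2 : f \in Lfun mu 2%:E).
Hypothesis f_mean0 : \int[mu]_x (f x)%:E = 0.

Let D := fine (dirichlet mu P f).
Let I := (\int[mu]_x f x ^+ 2)%R.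

Let D0 : (0 <= s * D)%R.
Proof. by rewrite mulr_ge0 ?(ltW s0)// fine_ge0// dirichlet_ge0. Qed.

Let I0 : (0 <= I)%R. Proof. by apply: Rintegral_ge0 => x _; exact: sqr_ge0. Qed.

Let sqr_setC (A : set E) : measurable A ->
  (I = \int[mu]_(x in ~` A) f x ^+ 2 + \int[mu]_(x in A) f x ^+ 2)%R.
Proof.
by move=> mA; rewrite addrC -Rintegral_setC//; exact: Lfun2_integrable_sqr_in.
Qed.

Let mean_setC (A : set E) : measurable A ->
  (\int[mu]_(x in ~` A) f x = - \int[mu]_(x in A) f x)%R.
Proof.
move=> mA; apply/eqP; rewrite -addr_eq0 addrC -Rintegral_setC//.
  by rewrite /Rintegral f_mean0.
exact: Lfun2_integrable.
Qed.

Lemma defect_bounded (A : set E) (m M : R) : measurable A ->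
  {ae mu, forall x, (m <= f x <= M)%R} ->
  (I - (fine (mu A) * \int[mu]_(x in A) f x ^+ 2
        - (\int[mu]_(x in A) f x) ^+ 2)
   <= fine (mu (~` A)) * (M - m) ^+ 2)%R.
Proof.
move=> mA fmM; rewrite (sqr_setC mA) fine_setC//.
have mAc := measurableC mA.
(* On the whole space the mean is 0, so these bounds become [m <= 0 <= M]. *)
have [mT TM _] := bounded_Rintegral f2 fmM measurableT.
have [_ _ JM] := bounded_Rintegral f2 fmM mA.
have [mAC AMC KM] := bounded_Rintegral f2 fmM mAc.
move: mT TM mAC AMC KM; rewrite probability_setT /= !mulr1.
rewrite mean_setC// fine_setC//.
rewrite {1 2}/Rintegral f_mean0/= => m0 M0 mAC AMC KM.
apply: bounded_variance_defect => //; first exact: fine_prob_itv.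
- by rewrite lerNl.
- by rewrite lerNr.
Qed.

Lemma admissible_sqr_le (A : set E) (mA : measurable A) (m M : R) :
  0 < mu A -> mu A / s%:E <= restr_gap mu P mA ->
  {ae mu, forall x, (m <= f x <= M)%R} ->
  (I <= s * D + fine (mu (~` A)) * (M - m) ^+ 2)%R.
Proof.
move=> A0 gap fmM; have := defect_bounded mA fmM.
have := restr_gap_sqr_le P_rev A0 f2 s0 gap; rewrite -/D; lra.
Qed.

(** The defect bound at the empty set, where the defect is [I] and the complement has mass 1. It
    accounts for the 1 in the minimum defining [restr_beta]. *)
Lemma sqr_le_osc (m M : R) : {ae mu, forall x, (m <= f x <= M)%R} ->
  (I <= (M - m) ^+ 2)%R.
Proof.
move=> fmM; have := defect_bounded measurable0 fmM.
by rewrite setC0 probability_setT !Rintegral_set0 measure0 /=; lra.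
Qed.

Lemma sqr_le_restr_beta_osc (m M : R) : {ae mu, forall x, (m <= f x <= M)%R} ->
  (I <= s * D + restr_beta mu P s * (M - m) ^+ 2)%R.
Proof.
move=> fmM; have Iosc := sqr_le_osc fmM.
have [w0|w0] := eqVneq ((M - m) ^+ 2)%R 0%R.
  by rewrite w0 mulr0 addr0 (le_trans Iosc)// w0.
have {}w0 : (0 < (M - m) ^+ 2)%R by rewrite lt_neqAle eq_sym w0 sqr_ge0.
(* Solved for [restr_beta], the claim is a lower bound on a minimum and an infimum, so it can be
   checked on each admissible set without a minimiser. *)
rewrite -lerBlDl -ler_pdivrMr// -lee_fin restr_betaE le_min; apply/andP; split.
  rewrite lee_fin ler_pdivrMr// mul1r lerBlDl.
  by apply: (le_trans Iosc); rewrite lerDr.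
apply: le_ereal_inf_tmp => _ [A [mA [A0 gap ->]]].
rewrite -(fineK (fin_num_measure _ _ (measurableC mA))) lee_fin.
by rewrite ler_pdivrMr// lerBlDl; exact: admissible_sqr_le.
Qed.

Lemma restr_beta0_sqr_le : restr_beta mu P s = 0%R -> (I <= s * D)%R.
Proof.
move=> b0; apply/ler_addgt0Pr => e e0.
(* The defect has three terms, each made at most [c], and [4 * c <= e]. The cap at 1 turns a bound
   [z < c] into [z ^+ 2 <= c]. *)
pose c := Num.min 1%R (e / 4)%R.
have c0 : (0 < c)%R by rewrite lt_min ltr01/=; lra.
have c1 : (c <= 1)%R by rewrite ge_min lexx.
have ce : (4 * c <= e)%R.
  have : (c <= e / 4)%R by rewrite ge_min lexx orbT.
  lra.
have i1 := Lfun2_integrable f2 measurableT.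
have i2 := Lfun2_integrable_sqr f2.
have [d1 [d10 h1]] := integral_normr_continuous i1 c0.
have [d2 [d20 h2]] := integral_normr_continuous i2 c0.
(* The cap at 1 excludes [1 < q0], so the infimum itself lies below [q0]. [d1] and [d2] come from
   absolute continuity of the integrals of [f] and [f ^+ 2]; the last bound controls [(1 - p) * J],
   with [I + 1] as a positive denominator. *)
pose q0 := Num.min 1%R (Num.min (Num.min d1 d2) (c / (I + 1))%R).
have q00 : (0 < q0)%R.
  by rewrite !lt_min d10 d20 ltr01/= divr_gt0// ltr_wpDl.
have : mine 1 (beta_inf mu P s) < q0%:E by rewrite -restr_betaE b0 lte_fin.
rewrite gt_min lte_fin {1}/q0 lt_min ltxx/=.
move=> /ereal_inf_lt[_ [A [mA [A0 gap ->]]]].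
have mAc := measurableC mA.
have qE : mu (~` A) = (fine (mu (~` A)))%:E by rewrite fineK// fin_num_measure.
have /andP[p1 _] := fine_prob_itv mAc.
rewrite qE lte_fin !lt_min => /and3P[_ /andP[qd1 qd2]].
rewrite ltr_pdivlMr ?ltr_wpDl// => qI.
have K1 : (\int[mu]_(x in ~` A) f x ^+ 2 < c)%R.
  apply: le_lt_trans (h2 _ mAc _); last by rewrite -lte_fin -qE in qd2.
  rewrite (@eq_Rintegral _ _ _ _ _ (fun x => `|f x ^+ 2|)%R)// => x _.
  by rewrite ger0_norm// sqr_ge0.
have a1 : ((\int[mu]_(x in A) f x) ^+ 2 <= c)%R.
  have : (`|\int[mu]_(x in ~` A) f x| < c)%R.
    apply: le_lt_trans (h1 _ mAc _); last by rewrite -lte_fin -qE in qd1.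
    by apply: le_normr_Rintegral => //; exact: Lfun2_integrable.
  rewrite mean_setC// normrN -[X in (X <= _)%R]real_normK ?num_real//.
  have := normr_ge0 (\int[mu]_(x in A) f x)%R; set z := `|_|%R => z0 zc.
  by nra.
have := restr_gap_sqr_le P_rev A0 f2 s0 gap; rewrite -/D.
have := sqr_setC mA; move: qI; rewrite fine_setC//.
have : (0 <= \int[mu]_(x in ~` A) f x ^+ 2)%R.
  by apply: Rintegral_ge0 => x _; exact: sqr_ge0.
move: K1 a1 p1; rewrite fine_setC//.
set K := (\int[mu]_(x in ~` A) _)%R; set J := (\int[mu]_(x in A) (_ ^+ 2))%R.
move=> K1 a1 p1 K0 qI IE le.
have : ((1 - fine (mu A)) * J <= (1 - fine (mu A)) * (I + 1))%R.
  by rewrite ler_wpM2l//; lra.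
lra.
Qed.

Lemma Lnorm2_sqr_le_osc : ('N[mu]_2%:E[EFin \o f]) ^+ 2 <=
  s%:E * dirichlet mu P f + (restr_beta mu P s)%:E * osc mu f ^+ 2.
Proof.
rewrite Lnorm2_sqr -(fineK (dirichlet_fin_num P_rev f2)) -/D.
rewrite -[X in X <= _]fineK; last first.
  by apply: integrable_fin_num => //; exact: Lfun2_integrable_sqr_in.
rewrite -/(Rintegral _ _ _) -/I.
have [/osc_bounded[m [M [-> fmM]]]|] := ltP (osc mu f) +oo.
  by rewrite -EFin_expe -!EFinM -EFinD lee_fin; exact: sqr_le_restr_beta_osc.
rewrite leye_eq expe2 => /eqP ->; rewrite mulyy.
(* With infinite oscillation the last term is 0 if [restr_beta] vanishes, by [0 * +oo = 0], and
   [+oo] otherwise. *)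
have [b0|b0] := eqVneq (restr_beta mu P s) 0%R.
  by rewrite b0 mul0e adde0 -EFinM lee_fin; exact: restr_beta0_sqr_le.
by rewrite gt0_muley ?addey ?leey// lte_fin lt_neqAle eq_sym b0 restr_beta_ge0.
Qed.
End inequality.

Lemma weak_poincare_restr_beta :
  weak_poincare mu P (fun f => osc mu f ^+ 2) (restr_beta mu P).
Proof.
split=> [s _|s t|s f s0 f2 f0]; first exact: restr_beta_ge0.
  exact: restr_beta_nincr.
exact: Lnorm2_sqr_le_osc.
Qed.
End weak_poincare.

Unset Implicit Arguments.
Set Strict Implicit.
Local Close Scope ereal_scope.

(** The limit is a genuine assumption of the second clause: for the identity kernel and an atomless
    [mu], every set of positive measure has gap 0, so [restr_beta] equals 1 at every positive
    [s]. *)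
Theorem theorem85 (d : measure_display) (E : measurableType d) (R : realType)
    (mu : probability E R) (P : R.-pker E ~> E) (P_rev : reversible mu P) :
  weak_poincare mu P (fun f => (osc mu f ^+ 2)%E) (restr_beta mu P) /\
  (restr_beta mu P s @[s --> +oo] --> (0 : R) ->
   WPI mu P (fun f => (osc mu f ^+ 2)%E) (restr_beta mu P)).
Proof.
have wp := weak_poincare_restr_beta P_rev.
by split=> [//|beta0]; split.
Qed.
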